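(* For every integer $n\ge 0$, Dyck paths of length $2n$ are in one-to-one correspondence with the permutations in $\mathcal{S}_n$ that avoid the pattern $(b\text{-}ac)$. Hence $$|\mathcal{S}_n(b\text{-}ac)|=\frac{1}{n+1}\binom{2n}{n}.$$
   Context: $\mathcal{S}_n$ is the set of permutations of $[n]=\{1,2,\ldots,n\}$, written as words $\pi=a_1a_2\cdots a_n$ (with $\mathcal{S}_0$ consisting of the empty word only). A (generalised) pattern is a word in distinct letters of the ordered alphabet $a<b<c<\cdots$ in which two adjacent letters may or may not be separated by a dash. A $p$-subword of $\pi$ is a subword $a_{i_1}a_{i_2}\cdots a_{i_k}$ ($i_1<i_2<\cdots<i_k$) whose letters are in the same relative order as the letters of $p$, and such that $i_{j+1}=i_j+1$ whenever the $j$th and $(j+1)$st letters of $p$ are not separated by a dash. For example, a $(b\text{-}ac)$-subword of $\pi$ is a subword $a_ia_ja_{j+1}$ with $i<j$ and $a_j<a_i<a_{j+1}$. A permutation avoids $p$ if it has no $p$-subword; $\mathcal{S}_n(p)$ is the set of permutations in $\mathcal{S}_n$ avoiding $p$. A Dyck path of length $2n$ is a lattice path from $(0,0)$ to $(2n,0)$ with steps $(1,1)$ and $(1,-1)$ that never goes below the $x$-axis. *)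

(* Defs.v *)
From HB Require Import structures.
From mathcomp Require Import all_boot all_order all_fingroup all_algebra.

Set Implicit Arguments.
Unset Strict Implicit.
Unset Printing Implicit Defensive.

Import Order.TTheory GRing.Theory Num.Theory.
Local Open Scope nat_scope.

(* Only the relative order of the letters matters; a, b, c, ... are 0, 1, 2, ...
   The j-th entry of [dashes] says whether letters j and j+1 (counted from 0)
   are separated by a dash. *)
Record pattern := Pattern {
  plen : nat;
  letters : plen.-tuple nat;
  dashes : plen.-1.-tuple bool;
  letters_uniq : uniq letters }.

Definition is_psubword (p : pattern) (n : nat) (w : n.-tuple nat)
    (i : {ffun 'I_(plen p) -> 'I_n}) : bool :=
  [&& [forall j : 'I_(plen p), forall k : 'I_(plen p),
        (j < k) ==> (i j < i k)],
      [forall j : 'I_(plen p), forall k : 'I_(plen p),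
        (tnth w (i j) < tnth w (i k))
        == (tnth (letters p) j < tnth (letters p) k)]
    & [forall j : 'I_(plen p), forall k : 'I_(plen p),
        ((k == j.+1 :> nat) && ~~ nth true (dashes p) j)
        ==> (i k == (i j).+1 :> nat)]].

Definition avoids (p : pattern) (n : nat) (w : n.-tuple nat) : bool :=
  ~~ [exists i : {ffun 'I_(plen p) -> 'I_n}, is_psubword w i].

(* 'I_n is {0, ..., n-1}, hence the shift to letters in {1, ..., n}. *)
Definition perm_word (n : nat) (s : 'S_n) : n.-tuple nat :=
  [tuple (s i).+1 | i < n].

Definition avoiders (n : nat) (p : pattern) : {set 'S_n} :=
  [set s : 'S_n | avoids p (perm_word s)].

Definition b_ac : pattern :=
  @Pattern 3 [tuple 1; 0; 2] [tuple true; false] isT.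

Local Open Scope ring_scope.

(* A path is encoded by its steps, [true] standing for (1, 1) and [false] for
   (1, -1). *)
Definition step (up : bool) : int * int := (1, if up then 1 else -1).

Definition vertex (w : seq bool) (k : nat) : int * int :=
  \sum_(up <- take k w) step up.

Definition dyck_paths (n : nat) : {set (2 * n).-tuple bool} :=
  [set w : (2 * n).-tuple bool |
     (vertex w (2 * n) == ((2 * n)%N%:Z, 0))
     && [forall k : 'I_(2 * n).+1, 0 <= (vertex w k).2]].

(* Main.v *)
Require Import Defs.
From HB Require Import structures.
From mathcomp Require Import all_boot all_order all_fingroup all_algebra.
From mathcomp Require Import zify.

Import Order.TTheory GRing.Theory Num.Theory.

(** Both families are counted by the ballot numbers; having the same
    cardinality, they are in bijection, and the closed form of the ballot
    numbers yields the Catalan number.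

    Dyck paths: [ballot m h] satisfies the recurrence obtained by splitting on
    the first step of a path of [m] steps that starts at height [h], stays
    nonnegative and ends on the axis. Hence there are [ballot (2 * n) 0] Dyck
    paths of length [2 * n] ([card_dyck_paths]).

    Avoiders: every permutation of n+1 letters arises exactly once by putting
    a letter [v] in front of a permutation [s] of n letters, the letters of [s]
    that are at least [v] being shifted up by one ([lift_perm ord0 v s]). The
    new word avoids b-ac if and only if [s] does and no two adjacent letters
    x, y of [s] satisfy x < v <= y; then [v] is called a site of [s]
    ([avoid_cons]). After the insertion, the sites up to [v] persist, the
    sites above [v] are destroyed by the climb from the first letter [v] up to
    the largest letter, and the value above all letters is a site
    ([nsites_cons]). So if [s] has k sites, its k children have 2, ..., k+1
    sites: this is the Catalan generating tree.

    The two are matched by [ballot_sum]: the number of descendants, m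
    generations below, of a node of this tree with h+1 sites is
    [ballot (2 * m + h) h]. The sum of these numbers over the avoiders of a
    given size does not change when one goes up one level in the tree and
    increases m by one ([sum_ballot_nsites]); with m = 0 at size n it is the
    number of avoiders, and at the root it is [ballot (2 * n) 0]. *)

Local Open Scope ring_scope.
Local Open Scope nat_scope.

(** * Ballot numbers *)

Fixpoint ballot (m h : nat) : nat :=
  if m is m'.+1 then
    ballot m' h.+1 + (if h is h'.+1 then ballot m' h' else 0)
  else h == 0.

Lemma ballotSS m h : ballot m.+1 h.+1 = ballot m h.+2 + ballot m h.
Proof. by []. Qed.

Lemma ballotS0 m : ballot m.+1 0 = ballot m 1.
Proof. exact: addn0. Qed.

Lemma ballot_lt m h : m < h -> ballot m h = 0.
Proof.
elim: m h => [|m IHm] [|h] //= lt_mh.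
by rewrite !IHm //; lia.
Qed.

Lemma ballot_diag h : ballot h h = 1.
Proof. by elim: h => //= h IHh; rewrite IHh ballot_lt //; lia. Qed.

(** This says that [m, h |-> ballot (2 * m + h) h] obeys the recurrence of the
    generating tree in which a node with [h.+1] sites has one child with
    [j.+2] sites for each [j <= h]. For [h > 0] the last summand is the
    up-step term of the ballot recurrence, and the other summands add up to
    its down-step term. *)
Lemma ballot_sum m h :
  ballot (2 * m.+1 + h) h = \sum_(j < h.+1) ballot (2 * m + j.+1) j.+1.
Proof.
elim: h => [|h IHh].
  by rewrite big_ord_recl big_ord0 (_ : 2 * m.+1 + 0 = (2 * m + 1).+1) //; lia.
rewrite big_ord_recr -IHh (_ : 2 * m.+1 + h.+1 = (2 * m.+1 + h).+1); last lia.
rewrite ballotSS addnC (_ : 2 * m.+1 + h = 2 * m + h.+2) //; lia.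
Qed.

(** The reflection principle: among the words with [k] up-steps and [k + h]
    down-steps, read from height [h], those that go below the axis are
    equinumerous with the words having [(k + h).+1] down-steps. The proof only
    compares the ballot recurrence with Pascal's rule; at [h = 0], where the
    recurrence loses a term, the symmetry of an odd row of Pascal's triangle
    makes up for it. *)
Lemma ballot_bin k h :
  ballot (2 * k + h) h + 'C(2 * k + h, (k + h).+1) = 'C(2 * k + h, k + h).
Proof.
elim: k h => [|k IHk] h; first by rewrite ballot_diag binn bin_small.
elim: h => [|h IHh].
  have := IHk 1; rewrite !addn0 !addn1 (_ : 2 * k.+1 = (2 * k).+2) ?mulnS //.
  rewrite ballotS0 !(binS (2 * k).+1).
  have -> : 'C((2 * k).+1, k) = 'C((2 * k).+1, k.+1).
    by rewrite -[RHS]bin_sub; [congr 'C(_, _)|]; lia.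
  lia.
have := IHk h.+2; move: IHh.
rewrite (_ : 2 * k.+1 + h = 2 * k + h.+2); last lia.
rewrite (_ : 2 * k.+1 + h.+1 = (2 * k + h.+2).+1); last lia.
rewrite ballotSS (_ : k.+1 + h.+1 = (k.+1 + h).+1); last lia.
rewrite (_ : k + h.+2 = (k.+1 + h).+1); last lia.
rewrite !binS; lia.
Qed.

Lemma ballot_catalan n : n.+1 * ballot (2 * n) 0 = 'C(2 * n, n).
Proof.
have := ballot_bin n 0; rewrite !addn0 => def_ballot.
have := mul_bin_left (2 * n) n.
by rewrite (_ : 2 * n - n = n) -?def_ballot; [nia | lia].
Qed.

(** * Dyck paths *)

Fixpoint dyck_from (h : nat) (w : seq bool) : bool :=
  if w is up :: w' then
    if up then dyck_from h.+1 w' else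
    if h is h'.+1 then dyck_from h' w' else false
  else h == 0.

Lemma card_dyck_from m h :
  #|[set w : m.-tuple bool | dyck_from h w]| = ballot m h.
Proof.
elim: m h => [|m IHm] h.
  case: h => [|h] /=.
    rewrite -[RHS](expn0 #|{: bool}|) -card_tuple.
    by apply: eq_card => w; rewrite !inE tuple0.
  by apply: eq_card0 => w; rewrite !inE tuple0.
have cons_bij :
    bijective (fun p : bool * m.-tuple bool => [tuple of p.1 :: p.2]).
  exists (fun w => (thead w, [tuple of behead w])) => [[up w] | w].
    by congr (_, _); apply: val_inj.
  by rewrite -tuple_eta.
rewrite -sum1dep_card (reindex _ (onW_bij _ cons_bij)) /=.
rewrite -(pair_big_dep predT
            (fun up (w : m.-tuple bool) => dyck_from h (up :: w))
            (fun _ _ => 1)) /=.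
rewrite big_bool /= !sum1dep_card IHm.
case: h => [|h]; last by rewrite IHm.
by congr (_ + _); apply: eq_card0 => w; rewrite inE.
Qed.

Definition rise (w : seq bool) : int := (\sum_(up <- w) (step up).2)%R.

Lemma rise_nil : rise [::] = 0%R.
Proof. exact: big_nil. Qed.

Lemma rise_cons up w :
  rise (up :: w) = ((if up then 1 else -1) + rise w)%R.
Proof. exact: big_cons. Qed.

(** The abscissa of a vertex is just its index, so that only heights matter. *)
Lemma vertexE w k : vertex w k = ((size (take k w))%:Z, rise (take k w)).
Proof.
rewrite /vertex; elim: (take k w) => [|up v IHv].
  by rewrite big_nil rise_nil.
by rewrite big_cons IHv rise_cons; congr (_, _).
Qed.

Lemma dyck_fromP h w :
  reflect ((h%:Z + rise w = 0)%R /\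
           forall k, (0 <= h%:Z + rise (take k w))%R)
          (dyck_from h w).
Proof.
apply: (iffP idP).
  elim: w h => [|[] w IHw] h /=.
  - by move/eqP->; split=> [|k]; rewrite rise_nil.
  - case/IHw=> end0 nonneg; split=> [|[|k]].
    + by rewrite rise_cons; lia.
    + by rewrite rise_nil; lia.
    + by have := nonneg k; rewrite /= rise_cons; lia.
  - case: h => // h /IHw[end0 nonneg]; split=> [|[|k]].
    + by rewrite rise_cons; lia.
    + by rewrite rise_nil; lia.
    + by have := nonneg k; rewrite /= rise_cons; lia.
elim: w h => [|[] w IHw] h [end0 nonneg] /=.
- by move: end0; rewrite rise_nil; lia.
- move: end0; rewrite rise_cons => end0; apply: IHw; split; first lia.
  by move=> k; have := nonneg k.+1; rewrite /= rise_cons; lia.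
move: end0; rewrite rise_cons; case: h nonneg => [|h] nonneg end0.
  (* A down-step from height 0 breaks nonnegativity at the first vertex. *)
  by have := nonneg 1; rewrite /= take0 rise_cons rise_nil.
apply: IHw; split; first lia.
by move=> k; have := nonneg k.+1; rewrite /= rise_cons; lia.
Qed.

Lemma mem_dyck_paths n (w : (2 * n).-tuple bool) :
  (w \in dyck_paths n) = dyck_from 0 w.
Proof.
rewrite inE vertexE take_oversize ?size_tuple // xpair_eqE eqxx /=.
apply/andP/dyck_fromP => [[/eqP end0 /forallP nonneg] | [end0 nonneg]].
  split=> [|k]; rewrite add0r //.
  have [le_k | lt_k] := leqP k (2 * n).
    by have := nonneg (Ordinal (le_k : k < (2 * n).+1)); rewrite vertexE.
  by rewrite take_oversize ?end0 // size_tuple ltnW.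
split; first by rewrite -[eqbLHS]add0r; apply/eqP.
by apply/forallP=> k; rewrite vertexE /= -[leRHS]add0r.
Qed.

Lemma card_dyck_paths n : #|dyck_paths n| = ballot (2 * n) 0.
Proof.
by rewrite -card_dyck_from; apply: eq_card => w; rewrite mem_dyck_paths inE.
Qed.

(** * The generating tree of the avoiders *)

Lemma avoidersP n (s : 'S_n) :
  reflect (forall i j k : 'I_n, i < j -> k = j.+1 :> nat ->
             ~~ (s j < s i < s k))
          (s \in avoiders n b_ac).
Proof.
rewrite inE /avoids negb_exists.
apply: (iffP forallP) => [av i j k lt_ij def_k | av f].
  apply: contra (av [ffun x : 'I_3 => tnth [tuple i; j; k] x]).
  case/andP=> lt_ji lt_ik.
  apply/and3P; split; apply/forallP=> x; apply/forallP=> y;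
    rewrite !ffunE ?tnth_mktuple;
    case: x => [[|[|[|x]]] lt_x] //; case: y => [[|[|[|y]]] lt_y] //;
    rewrite ?tnth_mktuple !(tnth_nth i) ?(tnth_nth 0) /= ?def_k; lia.
pose o (x : nat) lt_x : 'I_(plen b_ac) := @Ordinal 3 x lt_x.
pose i := f (o 0 isT); pose j := f (o 1 isT); pose k := f (o 2 isT).
apply/negP=> /and3P[/forallP incr /forallP order /forallP adj].
have lt_ij : i < j by have /forallP/(_ (o 1 isT)) := incr (o 0 isT).
have def_k : k = j.+1 :> nat.
  by apply/eqP; have /forallP/(_ (o 2 isT)) := adj (o 1 isT).
have := av i j k lt_ij def_k.
have /forallP/(_ (o 0 isT)) := order (o 1 isT).
have /forallP/(_ (o 2 isT)) := order (o 0 isT).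
rewrite !tnth_mktuple !(tnth_nth 0) /= -/i -/j -/k; lia.
Qed.

(** Think of [v] as a cut between the letters below [v] and those at least [v];
    it is a site when the word never steps from the lower part directly to the
    upper part, which is what keeps a new first letter [v] from being the b of
    a b-ac. *)
Definition site n (s : 'S_n) (v : nat) : bool :=
  [forall j : 'I_n, forall k : 'I_n,
     (k == j.+1 :> nat) ==> ~~ (s j < v <= s k)].

Lemma siteP n (s : 'S_n) v :
  reflect (forall j k : 'I_n, k = j.+1 :> nat -> ~~ (s j < v <= s k))
          (site n s v).
Proof.
apply: (iffP forallP) => [ok j k /eqP def_k | ok j].
  by have /forallP/(_ k)/implyP := ok j; apply.
by apply/forallP=> k; apply/implyP=> /eqP; apply: ok.
Qed.

(** An occurrence of b-ac in the extended word either lies in the shifted copy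
    of [s], whose relative order is that of [s], or has the new first letter as
    its b. *)
Lemma avoid_cons n (s : 'S_n) (v : 'I_n.+1) :
  (lift_perm ord0 v s \in avoiders n.+1 b_ac)
    = (s \in avoiders n b_ac) && site n s v.
Proof.
apply/avoidersP/andP => [av | [/avoidersP av /siteP ok] i j k].
  split.
    apply/avoidersP=> i j k lt_ij def_k.
    have := av (lift ord0 i) (lift ord0 j) (lift ord0 k).
    rewrite !lift_perm_lift /= /bump /=; lia.
  apply/siteP=> j k def_k.
  have := av ord0 (lift ord0 j) (lift ord0 k).
  rewrite !lift_perm_lift lift_perm_id /= /bump /=; lia.
have [j' ->|->] := unliftP ord0 j; last by [].
have [k' ->|->] := unliftP ord0 k; last by [].
have [i' ->|->] := unliftP ord0 i.
  have := av i' j' k'.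
  rewrite !lift_perm_lift /= /bump /=; lia.
have := ok j' k'.
rewrite !lift_perm_lift lift_perm_id /= /bump /=; lia.
Qed.

Definition nsites n (s : 'S_n) : nat := count (site n s) (iota 0 n.+1).

(** The new first step starts at [v >= u], hence does not come from below [u];
    and shifting the letters from [v] on does not move them across [u]. *)
Lemma site_cons_le n (s : 'S_n) (v : 'I_n.+1) u :
  u <= v -> site n.+1 (lift_perm ord0 v s) u = site n s u.
Proof.
move=> le_uv; apply/siteP/siteP=> ok j k.
  have := ok (lift ord0 j) (lift ord0 k).
  rewrite !lift_perm_lift /= /bump /=; lia.
have [k' ->|->] := unliftP ord0 k; last by [].
have [j' ->|->] := unliftP ord0 j.
  have := ok j' k'.
  rewrite !lift_perm_lift /= /bump /=; lia.
rewrite lift_perm_id; lia.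
Qed.

Lemma site_max n (s : 'S_n) : site n s n.
Proof. by apply/siteP=> j k _; have := ltn_ord (s k); lia. Qed.

(** Never stepping across [u] upwards, a word that starts below [u] would
    remain below [u], and so miss its largest letter. *)
Lemma site_below_head n (s : 'S_n.+1) u :
  s ord0 < u <= n -> ~~ site n.+1 s u.
Proof.
case/andP=> lt0u le_un; apply/negP=> /siteP ok.
have below i (lt_in : i < n.+1) : s (Ordinal lt_in) < u.
  elim: i lt_in => [|i IHi] lt_in.
    by rewrite (_ : Ordinal _ = ord0) //; apply: val_inj.
  have lt_in' := ltnW lt_in.
  have := ok (Ordinal lt_in') (Ordinal lt_in) erefl.
  by rewrite IHi -ltnNge.
have := below _ (ltn_ord (s^-1 ord_max)%g).
rewrite (_ : Ordinal _ = (s^-1 ord_max)%g) ?permKV /=; last exact: val_inj.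
lia.
Qed.

Lemma nsites_cons n (s : 'S_n) (v : 'I_n.+1) :
  nsites n.+1 (lift_perm ord0 v s) = (count (site n s) (iota 0 v.+1)).+1.
Proof.
have le_vn : v <= n by rewrite -ltnS.
(* Split the values 0, ..., n+1 into those up to v, those in (v, n], and n+1. *)
rewrite /nsites (_ : n.+2 = v.+1 + (n - v + 1)); last lia.
rewrite iotaD count_cat iotaD count_cat /= add0n.
rewrite (_ : v.+1 + (n - v) = n.+1); last lia.
rewrite site_max addn0.
have -> : count (site n.+1 (lift_perm ord0 v s)) (iota v.+1 (n - v)) = 0.
  apply/eqP; rewrite -leqn0 leqNgt -has_count; apply/hasPn=> u.
  rewrite mem_iota => u_bnd; apply: site_below_head.
  rewrite lift_perm_id; lia.
rewrite addn1 site_cons_le //; congr (_ + _).+1.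
apply: eq_in_count => u; rewrite mem_iota => u_bnd.
by apply: site_cons_le; lia.
Qed.

(** The values of [count P (iota 0 v.+1)], for [v] satisfying [P], are the ranks
    1, 2, ... of these [v]. Applied to sites, it says that the children of a
    permutation with k sites have 2, ..., k+1 sites, once each. *)
Lemma sum_rank (P : pred nat) (F : nat -> nat) N :
  \sum_(v < N | P v) F (count P (iota 0 v.+1)) =
  \sum_(j < count P (iota 0 N)) F j.+1.
Proof.
elim: N => [|N IHN]; first by rewrite !big_ord0.
have cntE : count P (iota 0 N.+1) = count P (iota 0 N) + P N.
  by rewrite -addn1 iotaD count_cat /= addn0.
rewrite big_mkcond big_ord_recr -big_mkcond IHN.
rewrite (_ : @ord_max N = N :> nat) // cntE.
by case: (P N) => /=; rewrite ?addn0 // addn1 big_ord_recr.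
Qed.

(** Injectivity is enough, as (n+1)! = (n+1) n!. *)
Lemma lift_perm_bij n :
  bijective (fun p : 'S_n * 'I_n.+1 => lift_perm ord0 p.2 p.1).
Proof.
apply: inj_card_bij; last by rewrite card_prod !card_Sn card_ord factS mulnC.
case=> [s v] [t u] /= eq_st.
have def_u : v = u by rewrite -(lift_perm_id ord0 v s) eq_st lift_perm_id.
rewrite def_u in eq_st *; congr (_, _); apply/permP=> i.
by apply: (@lift_inj _ u); rewrite -!(lift_perm_lift ord0) eq_st.
Qed.

Lemma sum_avoiders_cons n (F : nat -> nat) :
  \sum_(t in avoiders n.+1 b_ac) F (nsites n.+1 t) =
  \sum_(s in avoiders n b_ac) \sum_(j < nsites n s) F j.+2.
Proof.
rewrite (reindex _ (onW_bij _ (lift_perm_bij n))) /=.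
under eq_bigl do rewrite avoid_cons.
under eq_bigr do rewrite nsites_cons.
rewrite -(pair_big_dep (mem (avoiders n b_ac))
            (fun s (v : 'I_n.+1) => site n s v)
            (fun s (v : 'I_n.+1) => F (count (site n s) (iota 0 v.+1)).+1)).
by apply: eq_bigr => s _; rewrite (sum_rank _ (fun k => F k.+1)).
Qed.

Lemma nsites_gt0 n (s : 'S_n) : 0 < nsites n s.
Proof.
by rewrite -has_count; apply/hasP; exists n; rewrite ?site_max // mem_iota /=.
Qed.

(** Each summand counts the descendants of [s], m generations below it; moving
    one level up the tree trades one unit of [n] for one of [m]. The root is
    the empty permutation, which has one site. *)
Lemma sum_ballot_nsites m n :
  \sum_(s in avoiders n b_ac)
     ballot (2 * m + (nsites n s).-1) (nsites n s).-1
  = ballot (2 * (m + n)) 0.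
Proof.
elim: n m => [|n IHn] m.
  have av0 (s : 'S_0) : s \in avoiders 0 b_ac by apply/avoidersP; case.
  have nsites0 (s : 'S_0) : nsites 0 s = 1.
    by rewrite /nsites /= site_max.
  under eq_bigl do rewrite av0.
  under eq_bigr do rewrite nsites0.
  by rewrite sum_nat_const card_Sn mul1n !addn0.
rewrite (sum_avoiders_cons n (fun k => ballot (2 * m + k.-1) k.-1)) /=.
rewrite addnS -addSn -IHn; apply: eq_bigr => s _.
by rewrite ballot_sum prednK ?nsites_gt0.
Qed.

(** * Comparing the two counts *)

Lemma card_avoiders n : #|avoiders n b_ac| = ballot (2 * n) 0.
Proof.
rewrite -[n in RHS]add0n -sum_ballot_nsites -sum1_card.
by apply: eq_bigr => s _; rewrite muln0 ballot_diag.
Qed.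

Lemma bij_of_eq_card (T U : finType) :
  #|T| = #|U| -> exists f : T -> U, bijective f.
Proof.
move=> eqTU; exists (enum_val \o cast_ord eqTU \o enum_rank).
apply: bij_comp; last exact: enum_rank_bij.
apply: bij_comp; first exact: enum_val_bij.
by exists (cast_ord (esym eqTU)); [apply: cast_ordK | apply: cast_ordKV].
Qed.

Local Open Scope ring_scope.

Theorem proposition22 (n : nat) :
  (exists f : {w : (2 * n).-tuple bool | w \in dyck_paths n} ->
              {s : 'S_n | s \in avoiders n b_ac},
     bijective f)
  /\ #|avoiders n b_ac|%:R = 1 / n.+1%:R * 'C(2 * n, n)%:R :> rat.
Proof.
split.
  by apply: bij_of_eq_card; rewrite !card_sig card_dyck_paths card_avoiders.
rewrite card_avoiders -ballot_catalan natrM mulrA mul1r mulVf ?mul1r //.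
by rewrite pnatr_eq0.
Qed.
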